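(* Let $G$ be a discrete group acting transitively on a countable set $X$, and let $\mu$ be a finitely supported, generating and symmetric probability measure on $G$ with Markov operator $P$. The action of $G$ on $X$ is amenable if and only if for every positive function $f:X\to\mathbb{R}$ that is superharmonic with respect to $\mu$ there exists a sequence $\{E_n\}$ of points of $X$ such that $\frac{Pf(E_n)}{f(E_n)}\to 1$ as $n\to\infty$.
   Context: The action is a left action and $X$ is nonempty. The action of $G$ on $X$ is amenable if there is a $G$-invariant mean (finitely additive probability measure) on $X$. The measure $\mu$ is finitely supported if $\mu(S)=1$ for some finite $S\subset G$; generating if $G=\bigcup_{n\ge 0}\mathrm{supp}(\mu^{*n})$, where $\mu^{*n}$ is the $n$-fold convolution; symmetric if $\mu(A)=\mu(A^{-1})$ for all $A\subset G$. The Markov operator is $Pf(x)=\sum_{g}\mu(g)f(gx)$. A function $f:X\to\mathbb{R}$ is superharmonic with respect to $\mu$ if $f(x)\ge Pf(x)$ for all $x\in X$. *)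

(* Defs.v *)
From HB Require Import structures.
From mathcomp Require Import all_boot all_order all_algebra.
From mathcomp Require Import all_classical all_reals all_analysis.

Set Implicit Arguments.
Unset Strict Implicit.
Unset Printing Implicit Defensive.

Import Order.TTheory GRing.Theory Num.Theory.
Import numFieldNormedType.Exports.

Local Open Scope classical_set_scope.
Local Open Scope ring_scope.

(* [discrete G] is [G] with the sigma-algebra of all its subsets, so that
   [probability (discrete G) R] is the type of probability measures on the
   discrete group [G]. The base point required by the hierarchy is the unit. *)
Definition discrete (G : groupType) : Type := G.

HB.instance Definition _ (G : groupType) := Group.on (discrete G).
HB.instance Definition _ (G : groupType) := isPointed.Build (discrete G) 1%g.
HB.instance Definition _ (G : groupType) :=
  @isMeasurable.Build default_measure_display (discrete G)
    discrete_measurable discrete_measurable0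
    discrete_measurableC discrete_measurableU.

Section Actions.
Context (G : groupType) (X : Type).
Implicit Type act : G -> X -> X.

Definition left_action act : Prop :=
  (forall x, act 1%g x = x) /\
  (forall g h x, act (g * h)%g x = act g (act h x)).

Definition transitive_action act : Prop := forall x y, exists g, act g x = y.

Definition is_mean (R : realType) (m : set X -> R) : Prop :=
  [/\ forall A, 0 <= m A,
      m [set: X] = 1 &
      forall A B, A `&` B = set0 -> m (A `|` B) = m A + m B].

Definition invariant_mean (R : realType) act (m : set X -> R) : Prop :=
  forall g A, m [set act g x | x in A] = m A.

Definition amenable_action (R : realType) act : Prop :=
  exists m : set X -> R, is_mean m /\ invariant_mean act m.

End Actions.

Section MeasuresOnGroup.
Context (R : realType) (G : groupType).
Implicit Types mu nu : set (discrete G) -> \bar R.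

Definition finitely_supported mu : Prop :=
  exists S : set (discrete G), finite_set S /\ mu S = 1%E.

Definition symmetric_measure mu : Prop :=
  forall A : set (discrete G), mu A = mu [set g^-1%g | g in A].

(* (mu * nu)(A) = int nu(g^-1 A) dmu(g), i.e. the image of the product measure
   under multiplication. *)
Definition convolution mu nu : set (discrete G) -> \bar R :=
  fun A => (\int[mu]_g nu [set h | A (g * h)%g])%E.

Fixpoint convolution_power mu (n : nat) : set (discrete G) -> \bar R :=
  if n is n'.+1 then convolution mu (convolution_power mu n')
  else \d_(1%g : discrete G).

Definition support_measure nu : set (discrete G) :=
  [set g | nu [set g] != 0%E].

Definition generating mu : Prop :=
  [set: discrete G] = \bigcup_n support_measure (convolution_power mu n).

(* The sum ranges over the [g] with nonzero summand, and is meaningful when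
   there are finitely many of them, in particular for finitely supported [mu]. *)
Definition markov_operator (X : Type) (act : G -> X -> X) mu (f : X -> R) : X -> R :=
  fun x => \sum_(g \in [set: discrete G]) fine (mu [set g]) * f (act g x).

Definition superharmonic (X : Type) (act : G -> X -> X) mu (f : X -> R) :
    Prop :=
  forall x, markov_operator act mu f x <= f x.

End MeasuresOnGroup.

(* Main.v *)
(* If m is an invariant mean and f > 0 satisfies Pf <= (1 - e) f, put
   F_g(x) = f(gx) / f(x), which is bounded for g in the support of mu. Since
   F_{g^-1}(gx) = 1 / F_g(x), invariance of m gives
   m(F_g) + m(F_{g^-1}) = m(F_g + 1 / F_g) >= 2, and by symmetry of mu the mean
   of Pf / f is at least 1, a contradiction. The F_g are replaced by
   discretizations with finite range, for which the integral against a finitely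
   additive m is a finite sum.

   Conversely, let Q = (I + P) / 2 and u_n = Q^n 1_o; the lazy Q is used because
   P itself may be periodic. If ||u_{n+1}|| <= r ||u_n|| in l^2(X) for all n and
   some r < 1, then for r < l < 1 the function f = sum_n l^-n u_n is finite,
   positive and satisfies Pf <= (2 l - 1) f, so Pf / f stays away from 1.
   Otherwise ||u_{n+1}|| / ||u_n|| comes arbitrarily close to 1; along such n the
   probability vectors u_n^2 / ||u_n||^2 are asymptotically invariant under the
   support of mu, and an ultralimit of them is an invariant mean. *)

Require Import Defs.
From HB Require Import structures.
From mathcomp Require Import all_boot all_order all_algebra.
From mathcomp Require Import finmap.
From mathcomp Require Import all_classical all_reals all_analysis.
From mathcomp Require Import ring lra.

Set Implicit Arguments.
Unset Strict Implicit.
Unset Printing Implicit Defensive.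

Import Order.TTheory GRing.Theory Num.Theory.
Import numFieldNormedType.Exports.

Local Open Scope classical_set_scope.
Local Open Scope ring_scope.

(** * Integration of functions with finite range against a mean *)

Section SimpleMean.
Context (R : realType) (X : Type) (m : set X -> R).
Hypothesis m_mean : is_mean m.

Lemma mean_set0 : m set0 = 0.
Proof.
case: m_mean => _ _ mU; have := mU set0 set0 (setI0 _); rewrite setU0.
by move=> /eqP; rewrite -subr_eq subrr => /eqP.
Qed.

(** Finite additivity, by induction on an enumeration of [B]: the fibres of [h] are pairwise
    disjoint. *)
Lemma mean_preimage (T : choiceType) (h : X -> T) (B : set T) : finite_set B ->
  m (h @^-1` B) = \sum_(t \in B) m (h @^-1` [set t]).
Proof.
case: m_mean => _ _ mU Bfin.
have disjoint_sum (s : seq T) : uniq s ->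
    m [set x | h x \in s] = \sum_(t <- s) m (h @^-1` [set t]).
  elim: s => [_|t s IH /andP[ts us]].
    by rewrite big_nil -[RHS]mean_set0; congr m; apply/seteqP; split.
  rewrite big_cons -IH// -mU; last first.
    by apply/seteqP; split => x //= [->]; rewrite (negPf ts).
  congr m; apply/seteqP; split => x /=; rewrite inE.
    by case/orP => [/eqP|]; [left|right].
  by case=> [->|->]; rewrite ?eqxx ?orbT.
rewrite fsbig_finite// -(disjoint_sum _ (fset_uniq _)); congr m.
by apply/seteqP; split => x /=; rewrite in_fset_set//; [exact: mem_set|exact: set_mem].
Qed.

(** A sum with infinitely many nonzero terms is 0 by default, so this is the integral of [F] against
    [m] when [F] has finite range, the only case of interest below. *)
Definition simple_mean (F : X -> R) : R :=
  \sum_(v \in [set: R]) v * m (F @^-1` [set v]).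

(** Change of variables. Applied with [h] the pair of two functions, it writes their integrals over
    one common finite index set; linearity and monotonicity then hold term by term. *)
Lemma simple_mean_comp (T : choiceType) (h : X -> T) (phi : T -> R) :
  finite_set (range h) ->
  simple_mean (phi \o h) = \sum_(t \in range h) phi t * m (h @^-1` [set t]).
Proof.
move=> hfin; have pfin : finite_set (phi @` range h) by exact: finite_image.
rewrite /simple_mean -(fsbig_widen (phi @` range h) setT)//; last first.
  move=> v [_ /= nv]; rewrite [X in m X](_ : _ = set0) ?mean_set0 ?mulr0//.
  apply/seteqP; split => x //= xv; apply: nv.
  by exists (h x) => //; exists x.
transitivity (\sum_(v \in phi @` range h) \sum_(t \in range h)
    if t \in phi @^-1` [set v] then phi t * m (h @^-1` [set t]) else 0).
  apply: eq_fsbigr => v _; rewrite -fsbig_mkcondr.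
  rewrite -(_ : h @^-1` (range h `&` phi @^-1` [set v]) = (phi \o h) @^-1` [set v]).
    rewrite mean_preimage ?mulr_fsumr; last exact: finite_setIl.
    by apply: eq_fsbigr => t; rewrite inE => -[_ /= ->].
  by apply/seteqP; split => [x []//|x xv]; split => //; exists x.
rewrite exchange_fsbig//; apply: eq_fsbigr => t; rewrite inE => ht.
transitivity (\sum_(v \in phi @` range h)
    if v \in [set phi t] then phi t * m (h @^-1` [set t]) else 0).
  by apply: eq_fsbigr => v _; congr (if _ then _ else _); apply/idP/idP; rewrite !inE.
rewrite -fsbig_mkcondr setIidr ?fsbig_set1// => _ ->; exact: imageP.
Qed.

Lemma finite_range_pair (T U : Type) (h : X -> T) (k : X -> U) :
  finite_set (range h) -> finite_set (range k) ->
  finite_set (range (fun x => (h x, k x))).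
Proof.
move=> hf kf; apply: sub_finite_set (finite_setX hf kf).
by move=> _ [x _ <-]; split; exists x.
Qed.

Lemma finite_range_comp (T U : Type) (h : X -> T) (k : T -> U) :
  finite_set (range h) -> finite_set (range (fun x => k (h x))).
Proof.
by move=> hf; rewrite -(image_comp h k); exact: finite_image.
Qed.

Lemma simple_meanD (F H : X -> R) :
  finite_set (range F) -> finite_set (range H) ->
  simple_mean (fun x => F x + H x) = simple_mean F + simple_mean H.
Proof.
move=> Ff Hf; have FHf := finite_range_pair Ff Hf.
rewrite (simple_mean_comp (fun p => p.1 + p.2) FHf).
rewrite (simple_mean_comp fst FHf) (simple_mean_comp snd FHf) -fsbig_split//.
by apply: eq_fsbigr => p _; rewrite mulrDl.
Qed.

Lemma simple_meanZ (c : R) (F : X -> R) : finite_set (range F) ->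
  simple_mean (fun x => c * F x) = c * simple_mean F.
Proof.
move=> Ff; rewrite (simple_mean_comp (fun v => c * v) Ff).
rewrite (simple_mean_comp id Ff) mulr_fsumr.
by apply: eq_fsbigr => v _; rewrite mulrA.
Qed.

Lemma finite_range_cst (c : R) : finite_set (range (fun _ : X => c)).
Proof. by apply: (@sub_finite_set _ _ [set c]) => // _ [x _ <-]. Qed.

Lemma simple_mean_cst (c : R) : simple_mean (fun=> c) = c.
Proof.
case: m_mean => _ mT _; rewrite /simple_mean -(fsbig_widen [set c] setT)//.
  rewrite fsbig_set1 [X in m X](_ : _ = setT) ?mT ?mulr1//.
  by apply/seteqP; split.
move=> v [_ /= nv]; rewrite [X in m X](_ : _ = set0) ?mean_set0 ?mulr0//.
by apply/seteqP; split => x //= cv; exact: nv.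
Qed.

Lemma le_simple_mean (F H : X -> R) :
  finite_set (range F) -> finite_set (range H) -> (forall x, F x <= H x) ->
  simple_mean F <= simple_mean H.
Proof.
move=> Ff Hf FH; have FHf := finite_range_pair Ff Hf.
rewrite (simple_mean_comp fst FHf) (simple_mean_comp snd FHf) !fsbig_finite//=.
rewrite big_seq [leRHS]big_seq; apply: ler_sum => p.
rewrite in_fset_set// inE => -[x _ <-] /=; rewrite ler_wpM2r//.
by case: m_mean.
Qed.

Lemma finite_range_sum (I : Type) (s : seq I) (F : I -> X -> R) :
  (forall i, finite_set (range (F i))) ->
  finite_set (range (fun x => \sum_(i <- s) F i x)).
Proof.
move=> Ff; elim: s => [|i s IH].
  apply: sub_finite_set (finite_range_cst 0) => _ [x _ <-].
  by exists x => //; rewrite big_nil.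
apply: sub_finite_set (finite_range_comp (fun p => p.1 + p.2)
  (finite_range_pair (Ff i) IH)).
by move=> _ [x _ <-]; exists x => //; rewrite big_cons.
Qed.

Lemma simple_mean_sum (I : Type) (s : seq I) (F : I -> X -> R) :
  (forall i, finite_set (range (F i))) ->
  simple_mean (fun x => \sum_(i <- s) F i x) = \sum_(i <- s) simple_mean (F i).
Proof.
move=> Ff; elim: s => [|i s IH].
  rewrite big_nil -[RHS](simple_mean_cst 0); congr simple_mean.
  by apply/funext => x; rewrite big_nil.
rewrite big_cons -IH -simple_meanD//; last exact: finite_range_sum.
by congr simple_mean; apply/funext => x; rewrite big_cons.
Qed.

End SimpleMean.

(** * Invariant means against superharmonic functions *)

Lemma simple_mean_act (R : realType) (G : groupType) (X : Type)
    (act : G -> X -> X) (m : set X -> R) (g : G) (F : X -> R) :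
  left_action act -> invariant_mean act m ->
  simple_mean m (fun x => F (act g x)) = simple_mean m F.
Proof.
move=> [act1 actM] minv; apply: eq_fsbigr => v _; congr (_ * _).
(* Translation by [g] maps the level set of [F (act g x)] onto the level set of [F] for the same
   value. *)
rewrite -[LHS](minv g); congr m; apply/seteqP; split => [_ [x /= <- <-]//|x /= xv].
by exists (act g^-1%g x); rewrite /= -actM mulgV act1.
Qed.

Lemma amenable_no_strict_superharmonic (R : realType) (G : groupType) (X : Type)
    (act : G -> X -> X) (m : set X -> R) (s : seq G) (w : G -> R) (f : X -> R) (e : R) :
  left_action act -> is_mean m -> invariant_mean act m ->
  (forall g, g \in s -> 0 < w g) -> \sum_(g <- s) w g = 1 ->
  perm_eq (map (fun g => g^-1%g) s) s -> (forall g, w g^-1%g = w g) ->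
  (forall x, 0 < f x) -> (forall x, \sum_(g <- s) w g * f (act g x) <= f x) ->
  0 < e -> exists x, (1 - e) * f x < \sum_(g <- s) w g * f (act g x).
Proof.
move=> [act1 actM] m_mean minv w_gt0 w1 sV wV f0 fsup e0.
apply: contrapT => /forallNP small.
have {}small x : \sum_(g <- s) w g * f (act g x) <= (1 - e) * f x.
  by rewrite leNgt; apply/negP/small.
(* Rounding with mesh [d] will give [1 - d] as a lower bound for the average of the integrals,
   against the upper bound [1 - e]; any [d < e] yields the contradiction. *)
pose d := e / 2; have d0 : 0 < d by rewrite divr_gt0.
pose F g x := f (act g x) / f x.
have F0 g x : 0 < F g x by rewrite divr_gt0.
(* [F g] is rounded down to a multiple of [d]. The value 0 for [g] outside [s], where [F g] need not
   be bounded, makes the range finite for every [g], as the lemmas on sums require. *)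
pose D g x := if g \in s then d * (Num.trunc (F g x / d))%:R else 0.
have D_le g x : g \in s -> D g x <= F g x.
  by move=> sg; rewrite /D sg mulrC -ler_pdivlMr// truncn_le divr_ge0// ltW.
have D_gt g x : g \in s -> F g x - d < D g x.
  move=> sg; rewrite /D sg ltrBlDr -[X in _ + X]mulr1 -mulrDr mulrC -ltr_pdivrMr//.
  by rewrite natr1 truncnS_gt.
(* A single term of the nonnegative sum defining Pf is already at most f. *)
have F_le g x : g \in s -> F g x <= (w g)^-1.
  move=> sg; rewrite ler_pdivrMr// ler_pdivlMl ?w_gt0//.
  apply: le_trans (fsup x); rewrite (perm_big _ (perm_to_rem sg)) big_cons lerDl.
  rewrite big_seq; apply: sumr_ge0 => h /mem_rem sh.
  by rewrite mulr_ge0// ltW// w_gt0.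
have D_finite g : finite_set (range (D g)).
  rewrite /D; have [sg|_] := boolP (g \in s); last exact: finite_range_cst.
  pose K := Num.trunc ((w g)^-1 / d).
  apply: sub_finite_set (finite_image (fun k : nat => d * k%:R) (finite_II K.+1)).
  move=> _ [x _ <-]; exists (Num.trunc (F g x / d)) => //=.
  by rewrite ltnS; apply: le_truncn; rewrite ler_pM2r ?invr_gt0// F_le.
pose I g := simple_mean m (D g).
have sum_le : \sum_(g <- s) w g * I g <= 1 - e.
  rewrite -[leRHS](simple_mean_cst m_mean (1 - e)).
  under eq_bigr do rewrite -simple_meanZ//.
  have wD_finite g : finite_set (range (fun x => w g * D g x)).
    exact: (finite_range_comp (fun v => w g * v)).
  rewrite -simple_mean_sum//; apply: le_simple_mean => //.
  - exact: finite_range_sum.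
  - exact: finite_range_cst.
  move=> x; apply: (@le_trans _ _ (\sum_(g <- s) w g * F g x)).
    rewrite big_seq [leRHS]big_seq; apply: ler_sum => g sg.
    by rewrite ler_wpM2l ?D_le// ltW// w_gt0.
  under eq_bigr do rewrite mulrA.
  by rewrite -mulr_suml ler_pdivrMr.
(* By invariance the second integrand may be evaluated at [act g x], where the ratio for the inverse
   of [g] is the reciprocal of [F g x]. Then t + 1/t >= 2, and each rounding costs at most [d]. *)
have I_pair g : g \in s -> 2 - d *+ 2 <= I g + I g^-1%g.
  move=> sg; have sVg : g^-1%g \in s by rewrite -(perm_mem sV) map_f.
  have DV_finite : finite_set (range (fun x => D g^-1%g (act g x))).
    by apply: sub_finite_set (D_finite g^-1%g) => _ [x _ <-]; exists (act g x).
  rewrite -[leLHS](simple_mean_cst m_mean) /I.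
  rewrite -[X in _ <= _ + X](simple_mean_act g _ (conj act1 actM) minv).
  rewrite -simple_meanD//; apply: le_simple_mean => //.
  - exact: finite_range_cst.
  - exact: (finite_range_comp (fun p => p.1 + p.2)
      (finite_range_pair (D_finite g) DV_finite)).
  move=> x; have := D_gt g x sg; have := D_gt _ (act g x) sVg.
  have FV : F g^-1%g (act g x) = (F g x)^-1.
    by rewrite /F -actM mulVg act1 invf_div.
  rewrite FV; have t0 := F0 g x; set t := F g x in t0 *.
  have : 2 <= t + t^-1.
    rewrite -subr_ge0 (_ : _ - 2 = (t - 1) ^+ 2 / t); last by field; rewrite gt_eqF.
    by rewrite divr_ge0 ?sqr_ge0// ltW.
  by move=> h2 hV hg; lra.
have sum_ge : (1 - d) * 2 <= \sum_(g <- s) w g * (I g + I g^-1%g).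
  have -> : (1 - d) * 2 = \sum_(g <- s) w g * (2 - d *+ 2).
    by rewrite -mulr_suml w1; ring.
  rewrite big_seq [leRHS]big_seq; apply: ler_sum => g sg.
  by rewrite ler_wpM2l ?I_pair// ltW// w_gt0.
have sum_inv : \sum_(g <- s) w g * I g^-1%g = \sum_(g <- s) w g * I g.
  rewrite -[RHS](perm_big _ sV) big_map /=.
  by apply: eq_bigr => g _; rewrite wV.
move: sum_ge; under eq_bigr do rewrite mulrDr.
by rewrite big_split /= sum_inv; move: sum_le; rewrite /d; lra.
Qed.

(** * Finitely supported measures on a discrete group *)

Section WeightsOfMeasure.
Context (R : realType) (G : groupType) (mu : probability (discrete G) R).
Local Notation w := (fun g : discrete G => fine (mu [set g])).

(** A finite set of full measure may contain null points. Discarding them leaves the exact support,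
    on which every weight is positive. *)
Lemma finitely_supported_weights : finitely_supported mu ->
  exists s : seq (discrete G), [/\ uniq s,
    forall g, (g \in s) = (w g != 0),
    \sum_(g <- s) w g = 1 &
    mu (~` [set` s]) = 0%E].
Proof.
move=> [S [Sfin muS]].
have w0 g : g \notin fset_set S -> w g = 0.
  rewrite in_fset_set// notin_setE => Sg.
  suff -> : mu [set g] = 0%E by [].
  have muSC : mu (~` S) = 0%E by rewrite probability_setC// muS subee.
  apply/eqP; rewrite -measure_le0 -muSC; apply: le_measure; rewrite ?inE//.
  by move=> _ ->.
have sum_w : \sum_(g <- fset_set S) w g = 1.
  have : (\sum_(g <- fset_set S) mu [set g] = 1)%E.
    rewrite -muS -[in RHS](fsbig_setU_set1 Sfin) measure_fsbig//; last first.
      by move=> g h _ _ [k [-> ->]].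
    by rewrite fsbig_finite.
  rewrite (eq_bigr (fun g => (w g)%:E)) => [|g _]; last first.
    by rewrite fineK// fin_num_measure.
  by rewrite sumEFin => -[].
set s := [seq g <- fset_set S | w g != 0].
have us : uniq s by rewrite filter_uniq// fset_uniq.
have {}sum_w : \sum_(g <- s) w g = 1.
  rewrite big_filter -sum_w [RHS](bigID (fun g => w g != 0))/=.
  by rewrite [X in _ + X]big1 ?addr0// => g; rewrite negbK => /eqP.
exists s; split => // [g|].
  by rewrite mem_filter; apply: andb_idr; apply: contraR => /w0 ->.
have sfin : finite_set [set` s] := finite_seq s.
rewrite probability_setC// -(fsbig_setU_set1 sfin) measure_fsbig//; last first.
  by move=> g h _ _ [k [-> ->]].
rewrite (eq_fsbigr (fun g => (w g)%:E)) => [|g _]; last first.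
  by rewrite fineK// fin_num_measure.
by rewrite -(fsbig_seq _ (fun g => (w g)%:E))// sumEFin sum_w subee.
Qed.

Lemma markov_operatorE (s : seq (discrete G)) (X : Type) (act : G -> X -> X)
    (f : X -> R) x :
  uniq s -> (forall g, (g \in s) = (w g != 0)) ->
  markov_operator act mu f x = \sum_(g <- s) w g * f (act g x).
Proof.
move=> us sE; rewrite /markov_operator (fsbigE s)// => [|g _].
  by apply: eq_bigl => g; rewrite in_setT.
by rewrite sE negbK => /eqP ->; rewrite mul0r.
Qed.

(** If no such [g] existed, the integrand of the convolution would vanish on [s], hence almost
    everywhere, and the integral would be 0. *)
Lemma support_convolution (s : seq (discrete G)) nu (k : discrete G) :
  mu (~` [set` s]) = 0%E -> (forall A, 0 <= nu A)%E ->
  support_measure (convolution mu nu) k ->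
  exists2 g, g \in s & support_measure nu (g^-1 * k)%g.
Proof.
move=> mus nu0 /=; rewrite /support_measure /= => /eqP conv_neq0.
apply: contrapT => none; apply: conv_neq0.
rewrite /convolution (ge0_ae_eq_integral (g := cst 0%E))//.
- exact: integral0.
- exists (~` [set` s]); split => //.
  move=> g /= Ng gs; apply: Ng => _.
  have [//|nz] := eqVneq (nu [set h | (g * h)%g = k]) 0%E.
  exfalso; apply: none; exists g => //=.
  suff -> : [set (g^-1 * k)%g] = [set h : discrete G | (g * h)%g = k] by [].
  by apply/seteqP; split => [h /= ->|h /= <-]; rewrite ?mulKg ?mulVKg.
Qed.

Lemma convolution_power_ge0 n A : (0 <= convolution_power mu n A)%E.
Proof. by elim: n A => [|n IH] A //=; exact: integral_ge0. Qed.

(** Each point in the support of the n-th convolution power is a product of n elements of [s], so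
    [s] generates the group as a monoid. *)
Lemma generating_ind (s : seq (discrete G)) (H : G -> Prop) :
  generating mu -> mu (~` [set` s]) = 0%E ->
  H 1%g -> (forall a h, a \in s -> H h -> H (a * h)%g) -> forall g, H g.
Proof.
move=> gen mus H1 HM g.
have : [set: discrete G] g by [].
rewrite gen => -[n _]; elim: n g => [|n IH] g /=.
  rewrite /support_measure /= diracE; have [|] := boolP (_ \in _); last by rewrite eqxx.
  by rewrite inE => /= <-.
move=> /(support_convolution mus (convolution_power_ge0 n))[a sa /IH Ha].
by rewrite -(mulVKg a g); exact: HM.
Qed.

End WeightsOfMeasure.

(** * Finitely supported functions and almost invariant vectors *)

Section FiniteSupportSums.
Context (R : realType) (X : choiceType).
Implicit Types F H : X -> R.

Definition finsupp F := finite_set (F @^-1` [set~ 0]).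

(** Stated for an arbitrary [K] so as to cover every pointwise combination of two functions that
    vanishes where both do. *)
Lemma finsupp2 F H (K : X -> R) : finsupp F -> finsupp H ->
  (forall x, F x = 0 -> H x = 0 -> K x = 0) -> finsupp K.
Proof.
move=> Ff Hf K0; apply: (@sub_finite_set _ _ (F @^-1` [set~ 0] `|` H @^-1` [set~ 0])).
  move=> x /= Kx; apply: contrapT => /not_orP[/contrapT F0 /contrapT H0].
  exact/Kx/K0.
by rewrite finite_setU.
Qed.

Lemma finsupp1 F (K : X -> R) : finsupp F -> (forall x, F x = 0 -> K x = 0) -> finsupp K.
Proof. by move=> Ff K0; apply: (finsupp2 Ff Ff) => x /K0. Qed.

Lemma finsupp_sum (I : Type) (s : seq I) (F : I -> X -> R) :
  (forall i, finsupp (F i)) -> finsupp (fun x => \sum_(i <- s) F i x).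
Proof.
move=> Ff; elim: s => [|i s IH].
  apply: (@sub_finite_set _ _ set0) => // x /=; rewrite big_nil; exact.
by apply: (finsupp2 (Ff i) IH) => x Fx; rewrite big_cons Fx add0r.
Qed.

Lemma fsumD F H : finsupp F -> finsupp H ->
  \sum_(x \in [set: X]) (F x + H x) =
  \sum_(x \in [set: X]) F x + \sum_(x \in [set: X]) H x.
Proof.
move=> Ff Hf; set A := F @^-1` [set~ 0] `|` H @^-1` [set~ 0].
have Afin : finite_set A by rewrite finite_setU.
have A0 x : (setT `\` A) x -> F x = 0 /\ H x = 0.
  by move=> [_ /not_orP[/contrapT F0 /contrapT H0]].
rewrite -!(fsbig_widen A setT)// ?fsbig_split// => x /A0[/= Fx Hx] /=;
  by rewrite ?Fx ?Hx ?addr0.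
Qed.

Lemma fsum_sum (I : Type) (s : seq I) (F : I -> X -> R) :
  (forall i, finsupp (F i)) ->
  \sum_(x \in [set: X]) \sum_(i <- s) F i x =
  \sum_(i <- s) \sum_(x \in [set: X]) F i x.
Proof.
move=> Ff; elim: s => [|i s IH].
  by rewrite big_nil fsbig1// => x _; rewrite big_nil.
rewrite big_cons -IH -fsumD//; last exact: finsupp_sum.
by apply: eq_fsbigr => x _; rewrite big_cons.
Qed.

Lemma ler_fsum F H : finsupp F -> finsupp H -> (forall x, F x <= H x) ->
  \sum_(x \in [set: X]) F x <= \sum_(x \in [set: X]) H x.
Proof.
move=> Ff Hf FH; rewrite -subr_ge0 -[- _]mulN1r mulr_fsumr -fsumD//; last first.
  by apply: (finsupp1 Ff) => x ->; rewrite mulr0.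
by apply: fsumr_ge0 => x _; rewrite mulN1r subr_ge0.
Qed.

Lemma ler_norm_fsum F : finsupp F ->
  `|\sum_(x \in [set: X]) F x| <= \sum_(x \in [set: X]) `|F x|.
Proof.
move=> Ff.
have nf : finsupp (fun x => `|F x|) by apply: (finsupp1 Ff) => x ->; rewrite normr0.
rewrite ler_norml; apply/andP; split; last by apply: ler_fsum => // x; exact: ler_norm.
rewrite -[leLHS]mulN1r mulr_fsumr; apply: ler_fsum => //.
  by apply: (finsupp1 nf) => x ->; rewrite mulr0.
by move=> x; rewrite mulN1r lerNl -normrN ler_norm.
Qed.

Lemma ler_fsum1 F x : finsupp F -> (forall y, 0 <= F y) ->
  F x <= \sum_(y \in [set: X]) F y.
Proof.
move=> Ff F0; rewrite -(fsbig_set1 +%R x F).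
rewrite [leLHS]fsbig_mkcond; apply: ler_fsum => //.
  by apply: (finsupp1 Ff) => y Fy; rewrite /patch; case: ifP.
by move=> y; rewrite /patch; case: ifP.
Qed.

End FiniteSupportSums.

(** Nonnegativity of the variance: expand the weighted sum of squared deviations from the mean
    [c]. *)
Lemma jensen_sqr (R : realType) (I : eqType) (s : seq I) (w a : I -> R) :
  (forall i, i \in s -> 0 <= w i) -> \sum_(i <- s) w i = 1 ->
  (\sum_(i <- s) w i * a i) ^+ 2 <= \sum_(i <- s) w i * a i ^+ 2.
Proof.
move=> w0 w1; set c := \sum_(i <- s) w i * a i.
have : 0 <= \sum_(i <- s) w i * (a i - c) ^+ 2.
  by rewrite big_seq sumr_ge0// => i si; rewrite mulr_ge0 ?w0 ?sqr_ge0.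
rewrite (eq_bigr (fun i => w i * a i ^+ 2 + (- 2 * c * (w i * a i) + c ^+ 2 * w i))).
  by rewrite !big_split /= -!mulr_sumr w1 -/c; nra.
by move=> i _; ring.
Qed.

(** * Invariant means as ultralimits *)

Lemma ultrafilter_cvg01 (R : realType) (U : set_system nat) (a : nat -> R) :
  UltraFilter U -> (forall k, 0 <= a k <= 1) -> exists l : R, a k @[k --> U] --> l.
Proof.
move=> UU a01.
have aU01 : U (a @^-1` [set` `[0, 1]]).
  by apply: filterE => k; rewrite /= in_itv/= a01.
(* Compactness gives a cluster point. It is a limit: the ultrafilter contains each neighbourhood [B]
   or its complement, and the complement does not meet [B]. *)
have [l [_ cl]] := @segment_compact R 0 1 (fmap a U) _ aU01; exists l => B lB.
have [//|UnB] := in_ultra_setVsetC (a @^-1` B) UU.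
by have [x [/= nBx Bx]] := cl (~` B) B UnB lB.
Qed.

(** The mean of [A] is the limit, along a free ultrafilter, of the mass that [p k] gives to [A]. The
    constant [C] may depend on [t]: for fixed [t] the quotient tends to 0, and [t] is arbitrary
    afterwards. *)
Lemma almost_invariant_mean (R : realType) (G : groupType) (X : choiceType)
    (act : G -> X -> X) (s : seq G) (p : nat -> X -> R) :
  left_action act ->
  (forall k x, 0 <= p k x) -> (forall k, finsupp (p k)) ->
  (forall k, \sum_(x \in [set: X]) p k x = 1) ->
  (forall g t, g \in s -> 0 < t -> exists C, forall k,
    \sum_(x \in [set: X]) `|p k (act g x) - p k x| <= C / k.+1%:R + t) ->
  exists m : set X -> R, is_mean m /\
    forall g A, g \in s -> m [set act g x | x in A] = m A.
Proof.
move=> [act1 actM] p0 pf p1 pinv.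
pose q k (A : set X) : R := \sum_(x \in [set: X]) p k x * \1_A x.
have qf k A : finsupp (fun x => p k x * \1_A x : R).
  by apply: (finsupp1 (pf k)) => x ->; rewrite mul0r.
have q0 k A : 0 <= q k A by apply: fsumr_ge0 => x _; rewrite mulr_ge0.
have q1 k A : q k A <= 1.
  by rewrite -(p1 k); apply: (ler_fsum (qf k A) (pf k)) => x; rewrite ler_piMr// indicE.
have [U [UU ooU]] := ultraFilterLemma (@eventually_filter).
have /choice[m qm] (A : set X) : exists l : R, q k A @[k --> U] --> l.
  by apply: ultrafilter_cvg01 => k; rewrite q0 q1.
have inv0 : (fun k => k.+1%:R^-1 : R) k @[k --> U] --> (0 : R).
  by apply: cvg_trans (@cvg_harmonic R); apply: cvg_app.
exists m; split.
  split.
  - by move=> A; apply: (cvgr_to_ge (qm A)); apply: nearW.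
  - apply: (cvg_unique _ (qm setT)) => //.
    rewrite (_ : (fun k => q k setT) = (fun=> 1)); first exact: cvg_cst.
    apply/funext => k; rewrite -(p1 k); apply: eq_fsbigr => x _.
    by rewrite indicT mulr1.
  - move=> A B AB0; apply: (cvg_unique _ (qm (A `|` B))) => //.
    rewrite (_ : (fun k => _) = (fun k => q k A + q k B)); first exact: cvgD.
    apply/funext => k; rewrite /q -fsumD//; apply: eq_fsbigr => x _.
    rewrite -mulrDr !indicE in_setU; congr (_ * _).
    have [xA|_] := boolP (x \in A); have [xB|_] := boolP (x \in B);
      rewrite /= ?addr0 ?add0r//.
    by have : (A `&` B) x by [split; exact: set_mem]; rewrite AB0.
move=> g A sg; apply/eqP; rewrite -subr_eq0 -normr_le0; apply/ler_addgt0Pl => t t0.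
rewrite addr0; have [C pC] := pinv g t sg t0.
have lhs : `|q k [set act g x | x in A] - q k A| @[k --> U] -->
    `|m [set act g x | x in A] - m A|.
  by apply: cvg_norm; apply: cvgB.
have rhs : C / k.+1%:R + t @[k --> U] --> (C * 0 + t : R).
  by apply: cvgD; [exact: cvgMl_tmp|exact: cvg_cst].
rewrite mulr0 add0r in rhs.
apply: (ler_cvg_to lhs rhs); apply: nearW => k; apply: le_trans (pC k).
have actK : cancel (act g) (act g^-1%g) by move=> x; rewrite -actM mulVg act1.
have actVK : cancel (act g^-1%g) (act g) by move=> x; rewrite -actM mulgV act1.
have act_bij : bijective (act g) by exists (act g^-1%g).
have gf : finsupp (fun x => p k (act g x)).
  apply: (sub_finite_set _ (finite_image (act g^-1%g) (pf k))) => x /= px.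
  by exists (act g x).
(* Substituting [act g x] for [x] turns the indicator of the translate of [A] into that of [A]; the
   two masses then differ by at most the l^1 distance bounded in [pC]. *)
have -> : q k [set act g x | x in A] = \sum_(x \in [set: X]) p k (act g x) * \1_A x.
  rewrite /q (reindex_fsbigT (act g) _ act_bij); apply: eq_fsbigr => x _; congr (_ * _).
  rewrite !indicE; congr ((nat_of_bool _)%:R); apply/idP/idP; rewrite !inE.
    by move=> [y Ay /(can_inj actK) <-].
  exact: imageP.
rewrite /q -[- _]mulN1r mulr_fsumr -fsumD; last 2 first.
- by apply: (finsupp1 gf) => x ->; rewrite mul0r.
- by apply: (finsupp1 (pf k)) => x ->; rewrite mul0r mulr0.
apply: le_trans (ler_norm_fsum _) _.
  by apply: (finsupp2 gf (pf k)) => x -> ->; rewrite !mul0r mulr0 addr0.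
apply: ler_fsum.
- by apply: (finsupp2 gf (pf k)) => x -> ->; rewrite !mul0r mulr0 addr0 normr0.
- by apply: (finsupp2 gf (pf k)) => x -> ->; rewrite subr0 normr0.
move=> x; rewrite mulN1r -mulrBl normrM ler_piMr// indicE.
by case: (x \in A); rewrite ?normr1 ?normr0.
Qed.

(** * The lazy random walk *)

(** The norm of l^2(X) is kept squared to avoid roots; decay rates of the norm therefore appear
    below as [r ^+ 2] and [(1 - c) ^+ 2]. *)
Definition norm2 (R : realType) (X : choiceType) (f : X -> R) : R :=
  \sum_(x \in [set: X]) f x ^+ 2.

Section LazyWalk.
Context (R : realType) (G : groupType) (X : choiceType).
Context (act : G -> X -> X) (s : seq G) (w : G -> R) (o : X).
Hypothesis act_left : left_action act.
Hypothesis w_gt0 : forall g, g \in s -> 0 < w g.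
Hypothesis w_sum1 : \sum_(g <- s) w g = 1.

Local Notation P f x := (\sum_(g <- s) w g * f (act g x)).

Definition lazy_step (f : X -> R) (x : X) : R := (f x + P f x) / 2.

Definition lazy_walk (n : nat) : X -> R := iter n lazy_step \1_[set o].

Lemma act_bij g : bijective (act g).
Proof.
have [act1 actM] := act_left.
by exists (act g^-1%g) => x; rewrite -actM ?mulVg ?mulgV act1.
Qed.

Lemma finsupp_act g (f : X -> R) : finsupp f -> finsupp (fun x => f (act g x)).
Proof.
move=> ff; have [act1 actM] := act_left.
apply: (sub_finite_set _ (finite_image (act g^-1%g) ff)) => x /= fx.
by exists (act g x) => //; rewrite -actM mulVg act1.
Qed.

Lemma finsupp_sqr (f : X -> R) : finsupp f -> finsupp (fun x => f x ^+ 2).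
Proof. by move=> ff; apply: (finsupp1 ff) => x ->; rewrite expr0n. Qed.

Lemma finsupp_lazy_step f : finsupp f -> finsupp (lazy_step f).
Proof.
move=> ff; have Pf : finsupp (fun x => P f x).
  apply: finsupp_sum => g; apply: (finsupp1 (finsupp_act g ff)) => x ->.
  by rewrite mulr0.
by apply: (finsupp2 ff Pf) => x fx Pfx; rewrite /lazy_step fx Pfx addr0 mul0r.
Qed.

Lemma finsupp_lazy_walk n : finsupp (lazy_walk n).
Proof.
elim: n => [|n]; last exact: finsupp_lazy_step.
apply: (sub_finite_set _ (finite_set1 o)) => x /=; rewrite indicE.
by case: (boolP (x \in _)); rewrite // inE.
Qed.

Lemma lazy_step_ge0 f : (forall x, 0 <= f x) -> forall x, 0 <= lazy_step f x.
Proof.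
move=> f0 x; rewrite divr_ge0// addr_ge0// big_seq sumr_ge0// => g sg.
by rewrite mulr_ge0// ltW// w_gt0.
Qed.

Lemma lazy_walk_ge0 n x : 0 <= lazy_walk n x.
Proof. by elim: n x => [|n IH] x; [rewrite /lazy_walk/= indicE|exact: lazy_step_ge0]. Qed.

Lemma norm2_gt0 (f : X -> R) x : finsupp f -> f x != 0 -> 0 < norm2 f.
Proof.
move=> ff fx; apply: lt_le_trans (ler_fsum1 x (finsupp_sqr ff) _) => [|y].
  by rewrite exprn_even_gt0.
exact: sqr_ge0.
Qed.

Lemma lazy_walk_gt0 n : 0 < lazy_walk n o.
Proof.
elim: n => [|n IH]; first by rewrite /lazy_walk/= indicE mem_set.
rewrite /lazy_walk iterS -/(lazy_walk n) divr_gt0// ltr_wpDr// big_seq sumr_ge0// => g sg.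
by rewrite mulr_ge0 ?lazy_walk_ge0// ltW// w_gt0.
Qed.

(* By the parallelogram law, Jensen's inequality applied to the averages
   [(f x + f (g x)) / 2] loses the squares of the increments. *)
Lemma norm2_lazy_step (f : X -> R) h : finsupp f -> h \in s ->
  norm2 (lazy_step f) + w h / 4 * norm2 (fun x : X => f (act h x) - f x) <= norm2 f.
Proof.
move=> ff sh; have fgf g := finsupp_act g ff.
have inc_f : finsupp (fun x => f (act h x) - f x).
  by apply: (finsupp2 (fgf h) ff) => x -> ->; rewrite subr0.
have sum_f : finsupp (fun x =>
    \sum_(g <- s) (w g / 2 * f x ^+ 2 + w g / 2 * f (act g x) ^+ 2)).
  apply: finsupp_sum => g; apply: (finsupp2 ff (fgf g)) => x -> ->.
  by rewrite expr0n/= mulr0 addr0.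
have step_f := finsupp_lazy_step ff.
rewrite /norm2 mulr_fsumr -fsumD; last 2 first.
- exact: finsupp_sqr.
- by apply: (finsupp1 inc_f) => x ->; rewrite expr0n mulr0.
apply: (@le_trans _ _ (\sum_(x \in [set: X])
    \sum_(g <- s) (w g / 2 * f x ^+ 2 + w g / 2 * f (act g x) ^+ 2))).
  apply: ler_fsum => //.
    by apply: (finsupp2 step_f inc_f) => x -> ->; rewrite !expr0n mulr0 addr0.
  move=> x; have -> : lazy_step f x = \sum_(g <- s) w g * ((f x + f (act g x)) / 2).
    rewrite /lazy_step -[f x in LHS]mul1r -[X in X * f x]w_sum1 mulr_suml.
    rewrite -big_split mulr_suml /=.
    by apply: eq_bigr => g _; field.
  rewrite -lerBrDr; apply: le_trans (jensen_sqr _ _ w_sum1) _.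
    by move=> g /w_gt0/ltW.
  (* Only the term of [h] keeps its defect in ((a + b)/2)^2 + (a - b)^2/4 = (a^2 + b^2)/2; for the
     other terms it is dropped. *)
  rewrite lerBrDr !(perm_big _ (perm_to_rem sh)) !big_cons /=.
  rewrite [X in X <= _](_ : _ = (w h / 2 * f x ^+ 2 + w h / 2 * f (act h x) ^+ 2) +
     \sum_(g <- rem h s) w g * ((f x + f (act g x)) / 2) ^+ 2); last by field.
  rewrite lerD2l big_seq [leRHS]big_seq; apply: ler_sum => g /mem_rem/w_gt0 wg.
  rewrite -subr_ge0 (_ : _ - _ = w g / 4 * (f x - f (act g x)) ^+ 2); last by field.
  by rewrite mulr_ge0 ?sqr_ge0// divr_ge0// ltW.
rewrite fsum_sum; last first.
  move=> g; apply: (finsupp2 ff (fgf g)) => x -> ->.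
  by rewrite expr0n/= mulr0 addr0.
rewrite (eq_bigr (fun g => w g * norm2 f)); first by rewrite -mulr_suml w_sum1 mul1r.
move=> g _; rewrite fsumD.
- rewrite -!mulr_fsumr /norm2 -(reindex_fsbigT (act g) (fun x => f x ^+ 2) (act_bij g)).
  by field.
- by apply: (finsupp1 ff) => x ->; rewrite expr0n mulr0.
- by apply: (finsupp1 (fgf g)) => x ->; rewrite expr0n mulr0.
Qed.

(** Little norm is lost in one step, so by [norm2_lazy_step] the increment along [h] is small:
    [w h / 4] times its squared norm is at most (1 - (1 - c)^2) [norm2 f] <= 2c [norm2 f]. Hence the
    constant 8. *)
Lemma slow_decay_increment (f : X -> R) h c t :
  finsupp f -> h \in s -> 0 < t -> (1 - c) ^+ 2 * norm2 f <= norm2 (lazy_step f) ->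
  \sum_(x \in [set: X]) `|f (act h x) ^+ 2 - f x ^+ 2| <=
    (8 / (w h * t) * c + t) * norm2 f.
Proof.
move=> ff sh t0 slow; have fhf := finsupp_act h ff; have wh := w_gt0 sh.
have inc_f : finsupp (fun x => f (act h x) - f x).
  by apply: (finsupp2 fhf ff) => x -> ->; rewrite subr0.
have norm_act : norm2 (fun x : X => f (act h x)) = norm2 f.
  by rewrite /norm2 -(reindex_fsbigT (act h) (fun x => f x ^+ 2) (act_bij h)).
(* AM-GM: [|a^2 - b^2| <= (a - b)^2 / t + t (a^2 + b^2) / 2] *)
apply: (@le_trans _ _ (t^-1 * norm2 (fun x : X => f (act h x) - f x) + t * norm2 f)).
  have -> : t * norm2 f = t / 2 * norm2 (fun x : X => f (act h x)) + t / 2 * norm2 f.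
    by rewrite norm_act; field.
  have sq1 : finsupp (fun x => t^-1 * (f (act h x) - f x) ^+ 2).
    by apply: (finsupp1 inc_f) => x ->; rewrite expr0n mulr0.
  have sq2 : finsupp (fun x => t / 2 * f (act h x) ^+ 2).
    by apply: (finsupp1 fhf) => x ->; rewrite expr0n mulr0.
  have sq3 : finsupp (fun x => t / 2 * f x ^+ 2).
    by apply: (finsupp1 ff) => x ->; rewrite expr0n mulr0.
  have sq23 : finsupp (fun x => t / 2 * f (act h x) ^+ 2 + t / 2 * f x ^+ 2).
    by apply: (finsupp2 sq2 sq3) => x -> ->; rewrite addr0.
  rewrite /norm2 !mulr_fsumr -!fsumD//; apply: ler_fsum.
  - by apply: (finsupp2 fhf ff) => x -> ->; rewrite subrr normr0.
  - by apply: (finsupp2 sq1 sq23) => x -> ->; rewrite addr0.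
  move=> x; move: (f (act h x)) (f x) => a b.
  (* Scaling the difference by [t] leaves a [t]-free inequality, |d (a + b)| <= d^2 + (a^2 + b^2)/2,
     which follows from the squares of d + a, d + b, d - a and d - b. *)
  have [d da] : exists d, a - b = t * d by exists ((a - b) / t); field; rewrite gt_eqF.
  have -> : t^-1 * (a - b) ^+ 2 = t * d ^+ 2 by rewrite da; field; rewrite gt_eqF.
  have -> : a ^+ 2 - b ^+ 2 = t * (d * (a + b)) by rewrite mulrA -da; ring.
  rewrite normrM gtr0_norm// -!mulrA -!mulrDr ler_pM2l// ler_norml.
  have := (sqr_ge0 (d + a), sqr_ge0 (d + b), sqr_ge0 (d - a), sqr_ge0 (d - b)).
  by move=> [[[? ?] ?] ?]; apply/andP; split; nra.
rewrite [leRHS]mulrDl lerD2r -(ler_pM2l (t0 : 0 < t)) mulVKf ?gt_eqF//.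
have := norm2_lazy_step ff sh; set D := norm2 (fun x : X => f (act h x) - f x) => step.
have -> : t * (8 / (w h * t) * c * norm2 f) = 8 * c * norm2 f / w h.
  by field; rewrite !gt_eqF.
rewrite ler_pdivlMr//.
have n0 : 0 <= norm2 f by apply: fsumr_ge0 => x _; exact: sqr_ge0.
have : 0 <= c ^+ 2 * norm2 f by rewrite mulr_ge0 ?sqr_ge0.
rewrite (_ : 8 * c * norm2 f = 8 * (c * norm2 f)) ?mulrA//.
move: slow.
rewrite (_ : _ * norm2 f = norm2 f - 2 * (c * norm2 f) + c ^+ 2 * norm2 f); last by ring.
by move: step; rewrite (_ : w h / 4 * D = D * w h / 4); [lra|field].
Qed.

(* If the norms decay like [r ^ n], the Green function of the lazy walk at
   [1 / l] with [r < l < 1] is finite. *)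
Lemma decay_strict_superharmonic (r : R) :
  transitive_action act ->
  (forall H : G -> Prop, H 1%g ->
    (forall a h, a \in s -> H h -> H (a * h)%g) -> forall g, H g) ->
  0 <= r < 1 ->
  (forall n, norm2 (lazy_walk n.+1) <= r ^+ 2 * norm2 (lazy_walk n)) ->
  exists (f : X -> R) (c : R),
    [/\ c < 1, forall x, 0 < f x & forall x, P f x <= c * f x].
Proof.
move=> act_tr gen /andP[r0 r1] decay.
(* The square of one value is at most the squared norm, which starts at 1 and decays by [r ^+ 2] at
   each step. *)
have u_le n x : lazy_walk n x <= r ^+ n.
  rewrite -(@ler_pXn2r _ 2)// ?nnegrE ?exprn_ge0 ?lazy_walk_ge0//.
  apply: (@le_trans _ _ (norm2 (lazy_walk n))).
    apply: (ler_fsum1 x (finsupp_sqr (finsupp_lazy_walk n))) => y; exact: sqr_ge0.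
  elim: n => [|n IH]; last first.
    apply: le_trans (decay n) _; rewrite [r ^+ n.+1]exprS exprMn.
    by rewrite ler_wpM2l ?sqr_ge0.
  rewrite /norm2 -(fsbig_widen [set o] setT)//.
    by rewrite fsbig_set1 /lazy_walk/= indicE mem_set.
  by move=> y [_ /= yo]; rewrite /lazy_walk /= indicE memNset// expr0n.
have [l /andP[rl l1]] : exists l, r < l < 1.
  by exists ((1 + r) / 2); apply/andP; split; lra.
have l0 : 0 < l by exact: le_lt_trans rl.
pose v x := series (fun n => lazy_walk n x / l ^+ n).
have v_nd x : {homo v x : m n / (m <= n)%N >-> m <= n}.
  move=> m n mn; rewrite /v/series/= (big_cat_nat (leq0n m) mn)//= lerDl.
  rewrite sumr_ge0// => k _.
  by rewrite divr_ge0 ?lazy_walk_ge0// exprn_ge0// ltW.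
have v_cvg x : cvgn (v x).
  apply: (@series_le_cvg _ _ (geometric 1 (r / l))).
  - by move=> n; rewrite divr_ge0 ?lazy_walk_ge0// exprn_ge0// ltW.
  - by move=> n; rewrite /geometric/= mul1r exprn_ge0// divr_ge0// ltW.
  - move=> n; rewrite /geometric/= mul1r expr_div_n.
    by rewrite ler_wpM2r// invr_ge0 exprn_ge0// ltW.
  - apply: is_cvg_geometric_series; rewrite ger0_norm ?divr_ge0// ?(ltW l0)//.
    by rewrite ltr_pdivrMr// mul1r.
pose f x := limn (v x).
have v_le n x : v x n <= f x by exact: nondecreasing_cvgn_le.
have f0 x : 0 <= f x.
  by apply: le_trans (v_le 0%N x); rewrite /v/series/= big_geq.
have fo : 0 < f o.
  apply: lt_le_trans (v_le 1%N o); rewrite /v/series/= big_nat1 expr0 divr1.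
  exact: lazy_walk_gt0.
(* A lazy step raises the index of every term by one, so it turns the n-th partial sum into [l]
   times the next one without its term of index 0. *)
have step_v n x : (v x n + P (v^~ n) x) / 2 <= l * f x.
  apply: (@le_trans _ _ (l * v x n.+1)); last by rewrite ler_wpM2l// ltW.
  have -> : (v x n + P (v^~ n) x) / 2 =
      \sum_(0 <= k < n) lazy_walk k.+1 x / l ^+ k.
    rewrite /v/series/=; under [X in _ + X]eq_bigr do rewrite mulr_sumr.
    rewrite exchange_big/= -big_split/= mulr_suml; apply: eq_bigr => k _.
    rewrite /lazy_step.
    under [X in _ + X]eq_bigr do rewrite mulrA.
    by rewrite -mulr_suml -mulrDl mulrAC.
  rewrite /v/series/= big_nat_recl// mulrDr mulr_sumr.
  rewrite (eq_bigr (fun k => l * (lazy_walk k.+1 x / l ^+ k.+1))).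
    by rewrite lerDr mulr_ge0 ?divr_ge0 ?lazy_walk_ge0// ltW.
  by move=> k _; rewrite [in RHS]exprS invfM mulrCA mulVKf// gt_eqF.
have Pf x : (f x + P f x) / 2 <= l * f x.
  have Pv_cvg : P (v^~ n) x @[n --> \oo] --> P f x.
    apply: cvg_big => [|g _]; first exact: add_continuous.
    by apply: cvgMl_tmp; exact: v_cvg.
  have lim_step : (v x n + P (v^~ n) x) / 2 @[n --> \oo] --> (f x + P f x) / 2.
    by apply: cvgMr_tmp; exact: (cvgD (v_cvg x) Pv_cvg).
  by apply: (cvgr_to_le lim_step); apply: nearW => n; exact: step_v.
have {}Pf x : P f x <= (2 * l - 1) * f x by have := Pf x; lra.
(* Minimum principle: where [f] vanishes, Pf is at most 0 while its terms are nonnegative. A zero of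
   [f] would thus spread along the whole orbit and reach [o], where [f] is positive. *)
have fM x a : a \in s -> f x = 0 -> f (act a x) = 0.
  move=> sa fx; have := Pf x; rewrite fx mulr0 => P0.
  apply/eqP; rewrite eq_le f0 andbT -(ler_pM2l (w_gt0 sa)) mulr0; apply: le_trans P0.
  rewrite (perm_big _ (perm_to_rem sa)) big_cons lerDl big_seq.
  rewrite sumr_ge0// => h /mem_rem sh.
  by rewrite mulr_ge0// ltW// w_gt0.
exists f, (2 * l - 1); split => // [|x]; first by lra.
rewrite lt_neqAle f0 andbT eq_sym; apply/eqP => fx.
have [g gx] := act_tr x o; move: fo; rewrite -gx.
suff -> : f (act g x) = 0 by rewrite ltxx.
have [act1 actM] := act_left; move: g {gx}; apply: gen; first by rewrite act1.
by move=> a h sa; rewrite actM; exact: fM.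
Qed.

End LazyWalk.

(** * The equivalence *)

Theorem theorem4 (R : realType) (G : groupType) (X : Type)
    (act : G -> X -> X) (mu : probability (discrete G) R)
    (act_left : left_action act)
    (X_nonempty : [set: X] !=set0)
    (X_countable : countable [set: X])
    (act_transitive : transitive_action act)
    (mu_finite : finitely_supported mu)
    (mu_generating : generating mu)
    (mu_symmetric : symmetric_measure mu) :
  amenable_action R act <->
  (forall f : X -> R,
     (forall x, 0 < f x) -> superharmonic act mu f ->
     exists E : nat -> X,
       (markov_operator act mu f (E n) / f (E n)) @[n --> \oo] --> (1 : R)).
Proof.
have [s [us sE w1 mus]] := finitely_supported_weights mu_finite.
pose w (g : G) : R := fine (mu [set (g : discrete G)]).
have w_gt0 g : g \in s -> 0 < w g.
  by rewrite sE => wg; rewrite lt_neqAle eq_sym wg fine_ge0.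
have PE f x : markov_operator act mu f x = \sum_(g <- s) w g * f (act g x).
  exact: markov_operatorE.
have gen (H : G -> Prop) : H 1%g ->
    (forall a h, a \in s -> H h -> H (a * h)%g) -> forall g, H g.
  exact: generating_ind mus.
split=> [[m [m_mean m_inv]] f f0 fsup|seq_exists].
  have wV g : w g^-1%g = w g.
    by rewrite /w [in RHS]mu_symmetric image_set1.
  have sV : perm_eq (map (fun g => g^-1%g) s) s.
    apply: uniq_perm => // [|g].
      by rewrite map_inj_uniq//; exact: invg_inj.
    rewrite [RHS]sE -/(w g) -wV -[RHS]sE -[g in LHS]invgK mem_map//; exact: invg_inj.
  have /choice[E EP] (n : nat) :
      exists x : X, (1 - n.+1%:R^-1) * f x < markov_operator act mu f x.
    have [| |x] := @amenable_no_strict_superharmonic R G X act m s w f n.+1%:R^-1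
      act_left m_mean m_inv w_gt0 w1 sV wV f0.
    - by move=> x; rewrite -PE.
    - by [].
    by exists x; rewrite PE.
  exists E; apply: (squeeze_cvgr (f := fun n => 1 - n.+1%:R^-1) (h := fun=> 1)).
  - apply: nearW => n; rewrite ler_pdivlMr// ler_pdivrMr// mul1r fsup andbT.
    exact/ltW/EP.
  - rewrite -[X in _ --> X]subr0; apply: cvgB; first exact: cvg_cst.
    exact: cvg_harmonic.
  - exact: cvg_cst.
have [x0 _] := X_nonempty.
(* [{classic X}] equips the bare type [X] with the choice structure needed for finite sums over
   it. *)
pose u := @lazy_walk R G {classic X} act s w x0.
have u_finsupp n : finsupp (u n) by exact: finsupp_lazy_walk.
have b_gt0 n : 0 < norm2 (u n).
  by apply: (@norm2_gt0 R {classic X} _ x0 (u_finsupp n)); rewrite gt_eqF// lazy_walk_gt0.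
have /choice[n nP] (k : nat) :
    exists n, (1 - k.+1%:R^-1) ^+ 2 * norm2 (u n) <= norm2 (u n.+1).
  (* Otherwise the norms decay at rate [1 - k.+1%:R^-1] (0 when [k] is 0), and the resulting [f] has
     Pf / f <= c < 1 everywhere, so no sequence of ratios tends to 1. *)
  apply: contrapT => /forallNP fast.
  have [| |f [c [c1 f0 Pf]]] := @decay_strict_superharmonic R G {classic X} act s w x0
    act_left w_gt0 (1 - k.+1%:R^-1) act_transitive gen.
  - by rewrite subr_ge0 invf_le1 ?ler1n//= gtrBl invr_gt0.
  - by move=> n; rewrite leNgt; apply/negP => /ltW; exact: fast.
  have [|E ratio_cvg] := seq_exists f f0.
    by move=> x; rewrite PE (le_trans (Pf x))// ler_piMl ?ltW.
  suff : 1 <= c by rewrite leNgt c1.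
  apply: (cvgr_to_le ratio_cvg); apply: nearW => n.
  by rewrite ler_pdivrMr// PE.
pose p k x := u (n k) x ^+ 2 / norm2 (u (n k)).
have [| | | |m [m_mean m_inv]] := @almost_invariant_mean R G {classic X} act s p act_left.
- by move=> k x; rewrite divr_ge0 ?sqr_ge0// ltW.
- move=> k; apply: (finsupp1 (u_finsupp (n k))) => x ux.
  by rewrite /p ux expr0n mul0r.
- by move=> k; rewrite /p -mulr_fsuml -/(norm2 (u (n k))) divff// gt_eqF.
(* The bound of [slow_decay_increment] at [c = k.+1%:R^-1], divided by the squared norm. *)
- move=> g t sg t0; exists (8 / (w g * t)) => k.
  rewrite (eq_fsbigr (fun x : {classic X} => `|u (n k) (act g x) ^+ 2 - u (n k) x ^+ 2| *
    (norm2 (u (n k)))^-1)) => [|x _].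
    rewrite -mulr_fsuml ler_pdivrMr//.
    exact: (@slow_decay_increment R G {classic X} act s w act_left w_gt0 w1).
  by rewrite /p -mulrBl normrM [X in _ * X]gtr0_norm// invr_gt0.
(* The elements preserving [m] include the unit and are stable under left multiplication by [s],
   hence exhaust the group. *)
exists m; split => //; apply: gen => [|a h sa m_h] A.
  have [act1 _] := act_left; congr m; apply/seteqP; split => [_ [x Ax <-]|x Ax].
    by rewrite act1.
  by exists x.
have [_ actM] := act_left; rewrite -[RHS](m_h A) -[RHS](m_inv a _ sa) image_comp.
by congr m; apply: eq_imagel => x _; rewrite /= actM.
Qed.
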